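(* Let $f:\mathbb{R}^n\to\mathbb{R}$ be twice continuously differentiable and segment smooth. Then for any $w_k\in\mathbb{R}^n$ there exist $c,\delta\in(0,1)$ such that the equality line search at $w_k$ along $-\nabla f(w_k)$ with parameters $c,\delta$, using a nonmonotone reference value $R_k$ (i.e. $R_k=f(w_k)+\epsilon_k$ with $\epsilon_k>0$), returns a step size $\eta_k$ which is large with $P=0$, i.e. (i) $\eta_k\ge\frac{1}{l(w_k,\eta_{w_k})}$ and (ii) $\eta_k>\frac{2}{l(w_k,\eta_{w_k})}$.
   Context: Segment smoothness. For $f\in C^1(\mathbb{R}^n)$, $w\in\mathbb{R}^n$, $\eta>0$, put $w_\eta:=w-\eta\nabla f(w)$ and $$l(w,\eta):=\sup_{\hat\eta\in(0,\eta]}\frac{\|\nabla f(w)-\nabla f(w_{\hat\eta})\|}{\|w-w_{\hat\eta}\|},$$ with the convention $0/0=0$. $f$ is segment smooth if for every $w\in\mathbb{R}^n$ there is $\eta_w>0$ such that $l(w,\eta_w)$ is bounded; as part of the same assumption (stated as being without loss of generality), $\eta_w\ge\frac{2}{l(w,\eta_w)}$. Large step sizes. For a sequence of step sizes $\{\eta_k\}$ with corresponding iterates $\{w_k\}$ and $P\in\mathbb{N}$, $\eta_k$ is large if (i) $\eta_k\ge\frac1{l(w_k,\eta_{w_k})}$ and (ii) there is an integer $p\in[0,P]$ with $\eta_{k+p}>\frac{2}{l(w_{k+p},\eta_{w_{k+p}})}$. Equality line search. Inputs: $w_k,d_k\in\mathbb{R}^n$, $c,\delta\in(0,1)$, an initial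 step size $\eta_{k,0}>0$, and a reference value $R_k\ge f(w_k)$ (here $d_k=-\nabla f(w_k)$). A step size $\eta$ is accepted if $f(w_k+\eta d_k)\le R_k+c\,\eta\,\nabla f(w_k)^Td_k$. If $\eta_{k,0}$ is not accepted, test $\delta\eta_{k,0},\delta^2\eta_{k,0},\dots$ and return the first accepted value. If $\eta_{k,0}$ is accepted, test $\delta^{-1}\eta_{k,0},\delta^{-2}\eta_{k,0},\dots$ until the first value $\delta^{-m}\eta_{k,0}$ that is not accepted, and return $\delta^{-m+1}\eta_{k,0}$.
   Formalization: The search need not return a step size (if ∇f(w_k)=0 every trial is accepted), so the formal claim is: either all increasing trials are accepted forever, or a step size is returned, and any returned one is large with P=0; c, δ may depend on ε_k, and η_w may be infinite when l=0. *)

(* Defs.v *)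
From HB Require Import structures.
From mathcomp Require Import all_boot all_order all_algebra.
From mathcomp Require Import all_classical all_reals all_analysis.

Set Implicit Arguments.
Unset Strict Implicit.
Unset Printing Implicit Defensive.

Import Order.TTheory GRing.Theory Num.Theory.
Import numFieldNormedType.Exports.

Local Open Scope classical_set_scope.
Local Open Scope ring_scope.

Definition dot (R : realType) (n : nat) (u v : 'rV[R]_n) : R :=
  \sum_(i < n) u 0 i * v 0 i.

(* The library norm `|u| on row vectors is the maximum norm (it induces the
   same topology); the paper's norm is the Euclidean one. *)
Definition enorm (R : realType) (n : nat) (u : 'rV[R]_n) : R :=
  Num.sqrt (dot u u).

Definition grad (R : realType) (n : nat) (f : 'rV[R]_n -> R)
    (w : 'rV[R]_n) : 'rV[R]_n :=
  \row_(i < n) 'D_(delta_mx 0 i) f w.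

(* In finite dimension, pointwise continuity of x |-> 'd g x v for every v is
   continuity of the differential x |-> 'd g x. *)
Definition C1 (R : realType) (V W : normedModType R) (g : V -> W) : Prop :=
  (forall x, differentiable g x) /\
  (forall v, continuous (fun x => 'd g x v)).

Definition C2 (R : realType) (n : nat) (f : 'rV[R]_n -> R) : Prop :=
  C1 f /\ C1 (grad f).

Definition grad_step (R : realType) (n : nat) (f : 'rV[R]_n -> R)
    (w : 'rV[R]_n) (h : R) : 'rV[R]_n :=
  w - h *: grad f w.

(* l(w, eta), a supremum in [0, +oo]; eta = +oo stands for the whole half-line.
   Division by zero in R returns zero, hence the convention 0 / 0 = 0; no other
   quotient by zero occurs. *)
Definition seg_lip (R : realType) (n : nat) (f : 'rV[R]_n -> R)
    (w : 'rV[R]_n) (eta : \bar R) : \bar R :=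
  ereal_sup [set (enorm (grad f w - grad f (grad_step f w h)) /
                  enorm (w - grad_step f w h))%:E
            | h in [set h : R | 0 < h /\ (h%:E <= eta)%E]].

(* etaw w is the eta_w chosen at w. In \bar R the inverse of 0 is +oo, so that
   2 / l = +oo when l = 0: then the last condition reads etaw w = +oo. Infinite
   values are allowed precisely because otherwise that condition would exclude
   every f with a stationary point, where l = 0. *)
Definition segment_smooth (R : realType) (n : nat) (f : 'rV[R]_n -> R)
    (etaw : 'rV[R]_n -> \bar R) : Prop :=
  forall w, [/\ (0 < etaw w)%E,
                (seg_lip f w (etaw w) < +oo)%E
              & (2%:E / seg_lip f w (etaw w) <= etaw w)%E].

Definition large_step (R : realType) (n : nat) (f : 'rV[R]_n -> R)
    (etaw : 'rV[R]_n -> \bar R) (P : nat)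
    (eta : nat -> R) (w : nat -> 'rV[R]_n) (k : nat) : Prop :=
  (1 / seg_lip f (w k) (etaw (w k)) <= (eta k)%:E)%E /\
  exists p : nat, (p <= P)%N /\
    (2%:E / seg_lip f (w (k + p)%N) (etaw (w (k + p)%N))
       < (eta (k + p)%N)%:E)%E.

Definition accepted (R : realType) (n : nat) (f : 'rV[R]_n -> R)
    (w d : 'rV[R]_n) (c Rk eta : R) : bool :=
  f (w + eta *: d) <= Rk + c * eta * dot (grad f w) d.

Definition equality_line_search (R : realType) (n : nat) (f : 'rV[R]_n -> R)
    (w d : 'rV[R]_n) (c delta eta0 Rk eta : R) : Prop :=
  if accepted f w d c Rk eta0 then
    exists m : nat,
      [/\ (0 < m)%N,
          ~~ accepted f w d c Rk (delta ^- m * eta0),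
          forall j, (j < m)%N -> accepted f w d c Rk (delta ^- j * eta0)
        & eta = delta ^- m.-1 * eta0]
  else
    exists m : nat,
      [/\ (0 < m)%N,
          accepted f w d c Rk (delta ^+ m * eta0),
          forall j, (j < m)%N -> ~~ accepted f w d c Rk (delta ^+ j * eta0)
        & eta = delta ^+ m * eta0].

(* The search returns no value because its increasing phase never stops, as
   happens when grad f w = 0 or when f decreases without bound along d. *)
Definition increases_forever (R : realType) (n : nat) (f : 'rV[R]_n -> R)
    (w d : 'rV[R]_n) (c delta eta0 Rk : R) : Prop :=
  forall m : nat, accepted f w d c Rk (delta ^- m * eta0).

(* Main.v *)
(** Write [L] for [l(w, eta_w)] and [g] for the gradient at [w].  Along the
    steepest descent ray the descent lemma gives
    [f (w - h g) <= f w - h |g|^2 + L h^2 |g|^2 / 2] for [h <= eta_w], so for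
    [h <= 2 / L] the acceptance test holds with slack at least
    [eps - 2 c |g|^2 / L], which is positive for small [c].  By continuity, every
    step up to some [b > 2 / L] is accepted; a returned step [eta] always
    satisfies [eta > delta b], as [eta / delta] was rejected, and it remains to
    take [delta >= (2 / L) / b].  When [L = 0], [eta_w] is
    infinite and the descent bound is linear on the whole ray, so every step is
    accepted and nothing is returned. *)
Require Import Defs.
From mathcomp Require Import all_boot all_order all_algebra.
From mathcomp Require Import all_classical all_reals all_analysis.
From mathcomp Require Import ring lra.
Import Order.TTheory GRing.Theory Num.Theory.
Import numFieldNormedType.Exports.
Local Open Scope ring_scope.

(** * Euclidean inner product and the Cauchy-Schwarz inequality *)

Section DotProduct.
Context {R : realType} {n : nat}.
Implicit Types (u v : 'rV[R]_n) (a : R).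

Lemma dotC u v : dot u v = dot v u.
Proof. by apply: eq_bigr => i _; rewrite mulrC. Qed.

Lemma dotBl u1 u2 v : dot (u1 - u2) v = dot u1 v - dot u2 v.
Proof. by rewrite -sumrB; apply: eq_bigr => i _; rewrite !mxE mulrBl. Qed.

Lemma dotZl a u v : dot (a *: u) v = a * dot u v.
Proof. by rewrite /dot mulr_sumr; apply: eq_bigr => i _; rewrite !mxE mulrA. Qed.

Lemma dotBr u v1 v2 : dot u (v1 - v2) = dot u v1 - dot u v2.
Proof. by rewrite !(dotC u) dotBl. Qed.

Lemma dotZr a u v : dot u (a *: v) = a * dot u v.
Proof. by rewrite !(dotC u) dotZl. Qed.

Lemma dotNr u v : dot u (- v) = - dot u v.
Proof. by rewrite -scaleN1r dotZr mulN1r. Qed.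

Lemma dot_ge0 u : 0 <= dot u u.
Proof. by apply: sumr_ge0 => i _; rewrite -expr2 sqr_ge0. Qed.

Lemma dot_eq0 u : dot u u = 0 -> u = 0.
Proof.
move=> /psumr_eq0P u0; apply/rowP => i; rewrite mxE.
have /eqP := u0 (fun i _ => sqr_ge0 (u 0 i)) i isT.
by rewrite mulf_eq0 orbb => /eqP.
Qed.

Lemma enorm_ge0 u : 0 <= enorm u.
Proof. exact: sqrtr_ge0. Qed.

Lemma sqr_enorm u : enorm u ^+ 2 = dot u u.
Proof. by rewrite sqr_sqrtr ?dot_ge0. Qed.

Lemma enormZ a u : 0 <= a -> enorm (a *: u) = a * enorm u.
Proof.
move=> a0; rewrite /enorm dotZl dotZr mulrA -expr2 sqrtrM ?sqr_ge0//.
by rewrite sqrtr_sqr ger0_norm.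
Qed.

Lemma enorm_eq0 u : enorm u = 0 -> u = 0.
Proof. by move=> u0; apply: dot_eq0; rewrite -sqr_enorm u0 expr0n. Qed.

(** Cauchy-Schwarz: for [v != 0], the squared norm of [dot v v *: u - dot u v *: v] is nonnegative
    and factors as [dot v v * (dot u u * dot v v - dot u v ^+ 2)]. *)
Lemma dot_le_enorm u v : dot u v <= enorm u * enorm v.
Proof.
have [->|v0] := eqVneq v 0.
  by rewrite -[X in dot u X](scale0r 0) dotZr mul0r mulr_ge0 ?enorm_ge0.
have vv0 : 0 < dot v v.
  by rewrite lt_neqAle dot_ge0 eq_sym andbT; apply: contra_neq v0 => /dot_eq0.
have := dot_ge0 (dot v v *: u - dot u v *: v).
rewrite dotBl !dotBr !dotZl !dotZr (dotC v u).
have -> : dot v v * (dot v v * dot u u) - dot v v * (dot u v * dot u v) -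
    (dot u v * (dot v v * dot u v) - dot u v * (dot u v * dot v v)) =
    dot v v * (dot u u * dot v v - dot u v ^+ 2) by ring.
rewrite pmulr_rge0// subr_ge0 -!sqr_enorm -exprMn => le_sq.
apply: le_trans (ler_norm _) _.
by rewrite -(@ler_pXn2r _ 2) ?nnegrE ?mulr_ge0 ?enorm_ge0// -normrX ger0_norm ?sqr_ge0.
Qed.

End DotProduct.

(** * Derivatives along a line *)

Lemma diff_gradE {R : realType} {n : nat} (f : 'rV[R]_n -> R) x v :
  differentiable f x -> 'D_v f x = dot (grad f x) v.
Proof.
move=> df; rewrite deriveE// {1}(row_sum_delta v) linear_sum.
by apply: eq_bigr => i _; rewrite linearZ mxE -deriveE// mulrC.
Qed.

Lemma is_derive_line {R : realType} {n : nat} (f : 'rV[R]_n -> R) x v (t : R) :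
  differentiable f (x + t *: v) ->
  is_derive t 1 (fun h : R => f (x + h *: v)) (dot (grad f (x + t *: v)) v).
Proof.
move=> df; rewrite -diff_gradE//.
have E : (fun h : R => h^-1 *: (((fun h : R => f (x + h *: v)) \o shift t) (h *: 1)
      - f (x + t *: v))) =
    (fun h : R => h^-1 *: ((f \o shift (x + t *: v)) (h *: v) - f (x + t *: v))).
  apply/funext => h /=; congr (_ *: (f _ - _)).
  by rewrite scalerDl [h%:A]mulr1 addrCA.
by split; [rewrite /derivable E; exact: diff_derivable|rewrite /derive E].
Qed.

(** * The descent lemma on the steepest descent ray *)

Section SteepestDescent.
Context {R : realType} {n : nat}.
Variables (f : 'rV[R]_n -> R) (w : 'rV[R]_n).
Hypothesis df : forall x, differentiable f x.
Let g := grad f w.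

(** The supremum runs over a nonempty set of nonnegative quotients, hence cannot be [-oo]. *)
Lemma seg_lip_ge0 (eta : \bar R) : (0 < eta)%E -> (0 <= seg_lip f w eta)%E.
Proof.
move=> eta0.
have [h [h0 heta]] : exists h : R, 0 < h /\ (h%:E <= eta)%E.
  case: eta eta0 => [r r0| _ |//]; first by exists r.
  by exists 1; rewrite ltr01 leey.
apply: (@le_trans _ _ (enorm (g - grad f (grad_step f w h)) /
    enorm (w - grad_step f w h))%:E); first by rewrite lee_fin divr_ge0 ?enorm_ge0.
by apply: ereal_sup_ubound; exists h.
Qed.

Lemma seg_lip_gradient_le (eta : \bar R) (L h : R) :
  seg_lip f w eta = L%:E -> 0 < h -> (h%:E <= eta)%E ->
  enorm (g - grad f (w - h *: g)) <= L * (h * enorm g).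
Proof.
move=> lipE h0 heta.
(* When [g = 0] the quotient is 0/0 and carries no information, but both sides vanish. *)
have [g0|g0] := eqVneq g 0.
  rewrite g0 scaler0 subr0 -/g g0 subrr.
  by rewrite -[X in enorm X](scale0r 0) enormZ// mul0r !mulr0.
have ng0 : 0 < enorm g.
  rewrite lt_neqAle enorm_ge0 andbT eq_sym.
  by apply: contra_neq g0 => /enorm_eq0.
rewrite -ler_pdivrMr ?mulr_gt0// -(enormZ _ _ (ltW h0)).
rewrite -lee_fin -lipE; apply: ereal_sup_ubound; exists h => //.
by rewrite /grad_step opprB addrCA subrr addr0.
Qed.

Lemma descent (eta : \bar R) (L h : R) :
  seg_lip f w eta = L%:E -> 0 < h -> (h%:E <= eta)%E ->
  f (w - h *: g) <= f w - h * dot g g + L * h ^+ 2 * dot g g / 2.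
Proof.
move=> lipE h0 heta.
(* [phi] is [f] on the ray minus its quadratic upper model, up to a constant. Showing that its
   derivative is nonpositive lets the mean value theorem replace the usual integral. *)
pose phi (t : R) := f (w + t *: - g) + (t * dot g g - L / 2 * dot g g * t ^+ 2).
have dphi (t : R) : is_derive t 1 phi (dot (grad f (w + t *: - g)) (- g) +
    (dot g g - L * dot g g * t)).
  have dl := @is_derive_line _ _ f w (- g) t (df _).
  have dq : is_derive t (1 : R) (fun t : R => t * dot g g - L / 2 * dot g g * t ^+ 2)
      (dot g g - L * dot g g * t).
    apply: is_derive_eq.
    by rewrite /GRing.scale/=; field.
  exact: is_deriveD dl dq.
have cphi : {within `[0, h], continuous phi}%classic.
  apply: continuous_subspaceT => t.
  apply: differentiable_continuous; apply/derivable1_diffP.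
  exact: (@ex_derive _ _ _ _ _ _ _ (dphi t)).
have [t + E] := MVT h0 (fun t _ => dphi t) cphi.
rewrite in_itv/= => /andP[t0 th].
(* The left side equals [dot (g - grad f (w - t *: g)) g - L * t * dot g g]; Cauchy-Schwarz and the
   segment bound at [t] control the first term. *)
have dle : dot (grad f (w + t *: - g)) (- g) + (dot g g - L * dot g g * t) <= 0.
  have teta : (t%:E <= eta)%E by apply: le_trans heta; rewrite lee_fin ltW.
  have := ler_wpM2r (enorm_ge0 g) (seg_lip_gradient_le _ _ _ lipE t0 teta).
  move=> /(le_trans (dot_le_enorm _ _)).
  rewrite dotBl dotNr scalerN -!mulrA -expr2 sqr_enorm; lra.
have : phi h <= phi 0 by rewrite -subr_le0 E subr0 mulr_le0_ge0// ltW.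
rewrite /phi scale0r addr0 scalerN; lra.
Qed.

End SteepestDescent.

(** * Termination of the search and a lower bound on its result *)

Lemma exists_expr_mul_le {R : realType} (delta eta0 b : R) :
  0 < delta < 1 -> 0 < b -> exists m, delta ^+ m * eta0 <= b.
Proof.
move=> /andP[d0 d1] b0.
have dn : `|delta| < 1 by rewrite ger0_norm ?ltW.
have /(@cvgr_le _ _ _ _ _ _)/(_ _ b0) [N _ HN] :
    ((fun m => delta ^+ m * eta0) @ \oo --> (0 : R))%classic.
  by rewrite -(mul0r eta0); apply: cvgMl; exact: cvg_expr.
by exists N; exact: (HN N (leqnn N)).
Qed.

Section LineSearch.
Context {R : realType} {n : nat}.
Variables (f : 'rV[R]_n -> R) (w d : 'rV[R]_n) (c delta eta0 Rk b : R).
Hypotheses (delta01 : 0 < delta < 1) (eta00 : 0 < eta0) (b0 : 0 < b).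
Hypothesis acc_le : forall h, 0 < h -> h <= b -> accepted f w d c Rk h.
Let acc := accepted f w d c Rk.

(** Backtracking stops because [delta ^+ m * eta0] tends to 0 and so falls below [b]. The increasing
    phase either never stops or has a least rejected exponent. *)
Lemma equality_line_search_exists :
  increases_forever f w d c delta eta0 Rk \/
  exists eta, equality_line_search f w d c delta eta0 Rk eta.
Proof.
have [d0 _] := andP delta01.
have [ok|rej] := boolP (acc eta0); last first.
  have exm : exists m, acc (delta ^+ m * eta0).
    have [m hm] := exists_expr_mul_le delta eta0 b delta01 b0.
    by exists m; apply: acc_le; rewrite ?mulr_gt0 ?exprn_gt0.
  right; case: (ex_minnP exm) => m mok mmin.
  exists (delta ^+ m * eta0); rewrite /equality_line_search -/(acc _) (negbTE rej).
  exists m; split=> //.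
    by case: m mok {mmin} => // ; rewrite expr0 mul1r (negbTE rej).
  by move=> j jm; apply/negP => /mmin; rewrite leqNgt jm.
have [ex|nex] := pselect (exists m, ~~ acc (delta ^- m * eta0)); last first.
  by left=> m; apply/negPn/negP => hm; apply: nex; exists m.
right; case: (ex_minnP ex) => k krej kmin.
exists (delta ^- k.-1 * eta0); rewrite /equality_line_search -/(acc _) ok.
exists k; split=> //.
  by case: k krej {kmin} => //; rewrite expr0 invr1 mul1r ok.
by move=> j jk; apply/negPn/negP => /kmin; rewrite leqNgt jk.
Qed.

Lemma equality_line_search_gt eta :
  equality_line_search f w d c delta eta0 Rk eta -> delta * b < eta.
Proof.
have [d0 _] := andP delta01.
have rej_gt h : 0 < h -> ~~ acc h -> b < h.
  by move=> h0; apply: contraNlt; exact: acc_le.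
suff main h e : 0 < h -> ~~ acc h -> delta * h = e -> delta * b < e.
  (* With [m.+1] for the stopping exponent, the rejected neighbour of the result has exponent [m.+1]
     in the increasing phase and [m] in the decreasing one. *)
  rewrite /equality_line_search; case: ifP => _ [[|m]] []// _.
    move=> rej _ ->; apply: (main _ _ _ rej); first by rewrite mulr_gt0 ?invr_gt0 ?exprn_gt0.
    by rewrite exprS invfM mulrA mulrA mulfV ?gt_eqF// mul1r.
  move=> _ /(_ m (leqnn _)) rej ->; apply: (main _ _ _ rej); last by rewrite exprS mulrA.
  by rewrite mulr_gt0 ?exprn_gt0.
by move=> h0 rej <-; rewrite ltr_pM2l ?rej_gt.
Qed.

End LineSearch.

(** * Acceptance of all steps up to some point beyond [2 / L] *)

Lemma accepted_beyond {R : realType} {n : nat} (f : 'rV[R]_n -> R) w (eta : \bar R)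
    (L eps : R) :
  (forall x, differentiable f x) -> seg_lip f w eta = L%:E -> 0 < L ->
  ((2 / L)%:E <= eta)%E -> 0 < eps ->
  exists c b, [/\ 0 < c < 1, 2 / L < b & forall h, 0 < h -> h <= b ->
    accepted f w (- grad f w) c (f w + eps) h].
Proof.
move=> df lipE L0 Leta eps0; set g := grad f w; set G := dot g g.
have G0 : 0 <= G := dot_ge0 g.
have twoL0 : 0 < 2 / L by rewrite divr_gt0.
have LG0 : 0 <= 2 / L * G by rewrite mulr_ge0// ltW.
have den0 : 0 < eps + 2 / L * G + 1 by lra.
(* Chosen so that [c * (2 / L) * G < eps]; the summand 1 keeps [c < 1] even when [G = 0]. *)
pose c := eps / (eps + 2 / L * G + 1).
have c0 : 0 < c by rewrite divr_gt0.
have c1 : c < 1 by rewrite ltr_pdivrMr// mul1r; lra.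
have cG : c * (2 / L) * G < eps.
  rewrite -mulrA /c mulrAC ltr_pdivrMr// ltr_pM2l//; lra.
have acc_le h : 0 < h -> h <= 2 / L -> f (w - h *: g) < f w + eps - c * h * G.
  move=> h0 hL.
  have heta : (h%:E <= eta)%E by apply: le_trans Leta; rewrite lee_fin.
  apply: le_lt_trans (descent f w df _ _ _ lipE h0 heta) _; rewrite -/g -/G.
  have Lh : L * h <= 2 by rewrite mulrC -ler_pdivlMr.
  have hG0 : 0 <= h * G by rewrite mulr_ge0// ltW.
  have LhG := ler_wpM2r hG0 Lh.
  have hcG : c * h * G <= c * (2 / L) * G by rewrite ler_wpM2r// ler_wpM2l// ltW.
  have -> : L * h ^+ 2 * G / 2 = L * h * (h * G) / 2 by ring.
  lra.
(* [psi h <= 0] is the acceptance test. Its strict form at [2 / L] survives on a ball of some radius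
   [r], and [r / 2] stays inside this open ball. *)
pose psi (h : R) := f (w + h *: - g) - (f w + eps - c * h * G).
have psi_neg : psi (2 / L) < 0.
  by rewrite /psi scalerN subr_lt0 acc_le ?divr_gt0.
have cpsi : {for 2 / L, continuous psi}.
  have dl := @is_derive_line _ _ f w (- g) (2 / L) (df _).
  apply: continuousB.
    apply: differentiable_continuous; apply/derivable1_diffP.
    exact: (@ex_derive _ _ _ _ _ _ _ dl).
  apply: continuousB; first exact: cvg_cst.
  apply: continuousM; last exact: cvg_cst.
  by apply: continuousM; [exact: cvg_cst|exact: cvg_id].
have /(@nbhs_ballP _ R)[r /= r0 Hr] : \forall h \near (2 / L), psi h < 0.
  by apply: (cvgr_lt _ cpsi).
exists c, (2 / L + r / 2); split; [by rewrite c0|by rewrite ltrDl divr_gt0|].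
move=> h h0 hb; rewrite /accepted dotNr mulrN -/g -/G.
have [hL|Lh] := leP h (2 / L); first by rewrite scalerN ltW// acc_le.
rewrite -subr_le0 ltW//; apply: (Hr h).
rewrite /ball /= ltr0_norm; lra.
Qed.

Lemma seg_lip_eq0_accepted {R : realType} {n : nat} (f : 'rV[R]_n -> R) w (c eps h : R) :
  (forall x, differentiable f x) -> seg_lip f w +oo%E = 0%E -> c < 1 -> 0 < eps ->
  0 < h -> accepted f w (- grad f w) c (f w + eps) h.
Proof.
move=> df lipE c1 eps0 h0.
have := descent f w df _ _ _ lipE h0 (leey _).
rewrite /accepted scalerN dotNr !mul0r addr0 mulrN => /le_trans; apply.
have : c * (h * dot (grad f w) (grad f w)) <= h * dot (grad f w) (grad f w).
  by rewrite ler_piMl ?(ltW c1)// mulr_ge0 ?dot_ge0// ltW.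
rewrite mulrA; lra.
Qed.

Theorem lemmaB9 (R : realType) (n : nat) (f : 'rV[R]_n -> R)
    (etaw : 'rV[R]_n -> \bar R) :
  C2 f -> segment_smooth f etaw ->
  forall (wk : 'rV[R]_n) (eps : R), 0 < eps ->
  exists c delta : R,
    [/\ 0 < c < 1, 0 < delta < 1 &
     forall eta0 : R, 0 < eta0 ->
       (increases_forever f wk (- grad f wk) c delta eta0 (f wk + eps) \/
        exists etak : R,
          equality_line_search f wk (- grad f wk) c delta eta0 (f wk + eps) etak)
       /\
       (forall (eta : nat -> R) (w : nat -> 'rV[R]_n) (k : nat),
          w k = wk ->
          equality_line_search f wk (- grad f wk) c delta eta0 (f wk + eps) (eta k) ->
          large_step f etaw 0 eta w k)].
Proof.
move=> [[df _] _] smooth wk eps eps0.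
have [etaw0 + Leta] := smooth wk.
have := seg_lip_ge0 f wk _ etaw0.
(* Segment smoothness excludes the value [+oo], nonnegativity excludes [-oo]. *)
case lipE : (seg_lip f wk (etaw wk)) Leta => [L| |] // Leta.
rewrite lee_fin => L0 _.
have [L0'|Lneq0] := eqVneq L 0.
  (* For [L = 0] any [c] and [delta] in (0,1) would do. *)
  have half01 : 0 < (2^-1 : R) < 1 by apply/andP; split; lra.
  exists 2^-1, 2^-1; split=> // eta0 eta00.
  have etawE : etaw wk = +oo%E.
    move: Leta; rewrite L0' inve0 gt0_muley ?lte_fin// leye_eq => /eqP//.
  have acc h : 0 < h -> accepted f wk (- grad f wk) 2^-1 (f wk + eps) h.
    apply: seg_lip_eq0_accepted => //; first by rewrite -etawE lipE L0'.
    by case/andP: half01.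
  have powN m : 0 < 2^-1 ^- m * eta0 by rewrite mulr_gt0 ?invr_gt0 ?exprn_gt0 ?invr_gt0.
  split; first by left=> m; exact: acc.
  (* A returned value would require a rejected step, so the claim is vacuous here. *)
  move=> eta w k _; rewrite /equality_line_search acc// => -[m [_]].
  by rewrite acc.
have {L0 Lneq0} L0 : 0 < L by rewrite lt_neqAle eq_sym Lneq0.
have divE x : (x%:E / L%:E)%E = (x / L)%:E by rewrite inver gt_eqF.
rewrite divE in Leta.
have [c [b [c01 Lb acc]]] := accepted_beyond f wk _ _ _ df lipE L0 Leta eps0.
have twoL0 : 0 < 2 / L by rewrite divr_gt0.
have b0 : 0 < b := lt_trans twoL0 Lb.
(* This makes [delta * b] equal to [2 / L], independently of [eta0]. *)
pose delta := (2 / L) / b.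
have delta01 : 0 < delta < 1 by rewrite divr_gt0// ltr_pdivrMr// mul1r.
exists c, delta; split=> // eta0 eta00; split.
  exact: equality_line_search_exists acc.
move=> eta w k wkE /(equality_line_search_gt _ _ _ _ _ _ _ _ delta01 eta00 acc).
rewrite divfK ?gt_eqF// => eta_gt.
rewrite /large_step; split; last exists 0%N; rewrite ?addn0 wkE lipE divE ?lte_fin//.
(* Condition (i) follows from (ii), since [1 / L <= 2 / L]. *)
rewrite lee_fin (le_trans _ (ltW eta_gt))// ler_pM2r ?invr_gt0//; lra.
Qed.
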